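(* Let $\hat C_n$ be any algorithm that satisfies $(1-\alpha)$-Median. Then, for any nonatomic distribution $P$ on $\mathbb{R}^d\times\mathbb{R}$, we have that $$\mathbb{P}\{Y_{n+1}\in\hat C_n(X_{n+1})\}\ge 1-\alpha .$$ That is, $\hat C_n$ satisfies $(1-\alpha)$-Predictive for all nonatomic distributions $P$.
   Context: The dimension $d\ge 1$ and sample size $n\ge 1$ are arbitrary, and $1-\alpha\in(0,1)$. The training data $\mathcal D=\{(X_1,Y_1),\ldots,(X_n,Y_n)\}$ and the test point $(X_{n+1},Y_{n+1})$ are drawn i.i.d. from a distribution $P$ on $\mathbb{R}^d\times\mathbb{R}$. The distribution $P$ is nonatomic if it has no point masses. An algorithm $\hat C_n$ maps the training data $\mathcal D$ to sets $\hat C_n(x)\subseteq\mathbb{R}$, one for each $x\in\mathbb{R}^d$; these are called confidence intervals for convenience, but in general they are arbitrary subsets of $\mathbb{R}$. $\mathrm{Median}(Y_{n+1}\mid X_{n+1})$ denotes the median of the conditional distribution of $Y_{n+1}$ given $X_{n+1}$. $\hat C_n$ satisfies distribution-free median coverage at level $1-\alpha$, denoted $(1-\alpha)$-Median, if $$\mathbb{P}\{\mathrm{Median}(Y_{n+1}\mid X_{n+1})\in\hat C_n(X_{n+1})\}\ge 1-\alpha\quad\text{for all distributions }P\text{ on }(X,Y)\in\mathbb{R}^d\times\mathbb{R},$$ where the probability is taken over the training data $\mathcal D$ and the test point $X_{n+1}$. $\hat C_n$ satisfies distribution-free predictive coverage at level $1-\alpha$, denoted $(1-\alpha)$-Predictive,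 if $\mathbb{P}\{Y_{n+1}\in\hat C_n(X_{n+1})\}\ge 1-\alpha$ for all distributions $P$ on $(X,Y)\in\mathbb{R}^d\times\mathbb{R}$, where the probability is taken over the training data $\mathcal D$ and the test point $(X_{n+1},Y_{n+1})$; satisfying it ''for all nonatomic distributions $P$'' means that this inequality holds for every nonatomic $P$.
   Formalization: ''Nonatomic'' is required of the distribution of X (no point masses in R^d), not only of P on R^d×R: with X constant, Y uniform, n=2, α=1/2 the claim as written fails. The coverage events are assumed measurable, and a fixed measurable choice of median is used. *)

(* Defs.v *)
From HB Require Import structures.
From mathcomp Require Import all_boot all_order all_algebra.
From mathcomp Require Import all_classical all_reals all_analysis.

Set Implicit Arguments.
Unset Strict Implicit.
Unset Printing Implicit Defensive.
Import Order.TTheory GRing.Theory Num.Theory.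
Local Open Scope classical_set_scope.
Local Open Scope ring_scope.
Local Open Scope ereal_scope.

(* The product sigma-algebra carried by d.-tuple R is the Borel one on R^d. *)
Notation covariate R d := (d.-tuple R).
Notation observation R d := (covariate R d * R)%type.

Section iid.
Context d (T : measurableType d) (R : realType) (P : probability T R).

Definition cons_pair n (w : T * n.-tuple T) : n.+1.-tuple T :=
  [tuple of w.1 :: w.2].

Lemma measurable_cons_pair n : measurable_fun setT (@cons_pair n).
Proof. exact: measurable_cons. Qed.

HB.instance Definition _ n :=
  isMeasurableFun.Build _ _ _ _ (@cons_pair n) (@measurable_cons_pair n).

(* The law of n independent draws from P, i.e. the n-fold product P^n. *)
Fixpoint iid n : probability (n.-tuple T) R :=
  match n with
  | 0 => dirac ([tuple] : 0.-tuple T)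
  | m.+1 => distribution (P \x iid m) (@cons_pair m)
  end.

Lemma iid_rectangle n (A : 'I_n -> set T) : (forall i, measurable (A i)) ->
  iid n [set D | forall i, A i (tnth D i)] = \prod_(i < n) P (A i).
Proof.
elim: n A => [|n IHn] A mA.
  by rewrite big_ord0 /= diracE mem_set//= => -[].
rewrite big_ord_recl -(IHn (fun i => A (lift ord0 i)))//.
rewrite -product_measure1E//; last first.
  rewrite (_ : [set _ | _] = \bigcap_(i in [set: 'I_n])
      ((fun D : n.-tuple T => tnth D i) @^-1` A (lift ord0 i))).
    apply: fin_bigcap_measurable => // i _.
    by rewrite -[X in measurable X]setTI; exact: measurable_tnth.
  by apply/seteqP; split => D /= h i; [move=> _|]; exact: h.
rewrite /= /distribution /pushforward; congr (_ _).
apply/seteqP; split => -[x D] /=.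
  move=> h; split; first by have := h ord0.
  by move=> i; have := h (lift ord0 i); rewrite tnthS.
move=> [h0 h] i; case: (unliftP ord0 i) => [j ->|->//].
by rewrite tnthS; exact: h.
Qed.
End iid.

Section conditional_median.
Context (R : realType).

Definition is_median (nu : set R -> \bar R) (m : R) :=
  (2^-1)%:E <= nu `]-oo, m]%classic /\ (2^-1)%:E <= nu `[m, +oo[%classic.

(* A distribution may have an interval of medians; med is a fixed rule that
   selects one of them (e.g. the smallest, the largest or the midpoint),
   measurably, so that the conditional median is a random variable. *)
Definition median_rule (med : (set R -> \bar R) -> R) :=
  (forall nu : probability R R, is_median nu (med nu)) /\
  (forall d (T : measurableType d) (k : R.-pker T ~> R),
    measurable_fun setT (fun x : T => med (k x))).

Context d (T : measurableType d).

HB.instance Definition _ :=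
  isMeasurableFun.Build _ _ (T * R)%type T fst measurable_fst.

Definition covariate_law (P : probability (T * R)%type R) : probability T R :=
  distribution P fst.

(* k is a regular version of the conditional distribution of Y given X when
   (X, Y) has law P; it is determined up to a covariate_law P-null set. *)
Definition conditional_law (P : probability (T * R)%type R)
    (k : R.-pker T ~> R) :=
  forall (A : set T) (B : set R), measurable A -> measurable B ->
    P (A `*` B) = \int[covariate_law P]_(x in A) k x B.
End conditional_median.

(* No point masses.  For a law P on R^d x R this has to be asked of the law of
   the covariate: absence of point masses of P in R^d x R alone would still
   allow X to be constant, and then coverage of the median does not give
   predictive coverage.  For instance let n = 2 and let C D x be
   `[min Y_1 Y_2, max Y_1 Y_2] if X_1 = X_2 = x, and R otherwise: it covers the
   conditional median with probability at least 1/2 under every P, but Y_3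
   with probability only 1/3 under P = dirac 0 \x uniform on `[0, 1]. *)
Definition nonatomic d (T : measurableType d) (R : realType)
  (mu : set T -> \bar R) := forall x : T, mu [set x] = 0.

Section coverage.
Context (R : realType) (d n : nat).

(* The set \hat C_n(x) computed from the training data D is C D x. *)
Definition algorithm :=
  n.-tuple (observation R d) -> covariate R d -> set R.

(* The training data together with the independent test point. *)
Definition sample_law (P : probability (observation R d) R) :
    probability (n.-tuple (observation R d) * observation R d)%type R :=
  iid P n \x P.

Implicit Type C : algorithm.

(* Makes the coverage events measurable, hence their probabilities meaningful;
   no regularity of C D x as a subset of R beyond this is assumed. *)
Definition measurable_algorithm C :=
  measurable [set w : n.-tuple (observation R d) * observation R d |
    C w.1 w.2.1 w.2.2].

Definition median_coverage (med : (set R -> \bar R) -> R) (alpha : R) C :=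
  forall (P : probability (observation R d) R) (k : R.-pker covariate R d ~> R),
    conditional_law P k ->
    (1 - alpha)%:E <=
      sample_law P [set w | C w.1 w.2.1 (med (k w.2.1))].

Definition predictive_coverage_at (alpha : R) C
    (P : probability (observation R d) R) :=
  (1 - alpha)%:E <= sample_law P [set w | C w.1 w.2.1 w.2.2].
End coverage.

(* Main.v *)
From HB Require Import structures.
Require Import Defs.
From mathcomp Require Import all_boot all_order all_algebra.
From mathcomp Require Import all_classical all_reals all_analysis.
From mathcomp Require Import measurable_realfun zify.
Import Order.TTheory GRing.Theory Num.Theory.
Local Open Scope classical_set_scope.
Local Open Scope ring_scope.

(** Covering the conditional median forces covering the response, because a
finite population with distinct covariates makes the two the same thing.

Draw a population [L] of [m] independent points from [P], and resample from
it: let [empirical R L] be the uniform law on the entries of [L].  As the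
covariate is nonatomic, almost surely no two entries of [L] share a covariate
([ae_distinct]).  Then the covariate determines the response under
[empirical R L]: the conditional law of [Y] given [X] is a point mass at
[label L X] ([conditional_law_empirical]), the median of a point mass is its
location ([med_dirac]), and coverage of the conditional median under
[empirical R L] is predictive coverage under [empirical R L]
([coverage_empirical]).

It remains to come back from [empirical R L] to [P].  A sample of size [k]
from [empirical R L] is obtained by drawing [k] indices uniformly with
replacement ([iid_empirical]).  Distinct indices pick independent draws from
[P] once [L] itself is averaged out ([iid_select]), and an index is repeated
with probability at most [k ^ 2 / m] ([expn_le_ffact]).  So averaging over
[L] the probability of an event under the resampled law exceeds its
probability under [P] by at most [k ^ 2 / m] ([integral_iid_empirical_le]).
With [k = n + 1], the bound [1 - alpha] passes to [P] as [m] grows. *)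

Set Implicit Arguments.
Unset Strict Implicit.
Unset Printing Implicit Defensive.

(** * Independent draws *)

Lemma measurable_rectangle d (T : measurableType d) k (A : 'I_k -> set T) :
  (forall i, measurable (A i)) ->
  measurable [set D : k.-tuple T | forall i, A i (tnth D i)].
Proof.
move=> mA.
rewrite (_ : [set _ | _] = \bigcap_(i in [set: 'I_k])
    ((fun D : k.-tuple T => tnth D i) @^-1` A i)).
  apply: fin_bigcap_measurable => // i _.
  by rewrite -[X in measurable X]setTI; exact: measurable_tnth.
by apply/seteqP; split => D /= h i; [move=> _|]; exact: h.
Qed.

(** Rectangles form a pi-system that generates the product sigma-algebra, so
[iid_rectangle] characterizes the product law. *)
Lemma iid_unique d (T : measurableType d) (R : realType) (P : probability T R)
    k (mu : {measure set (k.-tuple T) -> \bar R}) :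
  (forall A : 'I_k -> set T, (forall i, measurable (A i)) ->
    mu [set D | forall i, A i (tnth D i)] = (\prod_(i < k) P (A i))%E) ->
  forall E, measurable E -> mu E = iid P k E.
Proof.
move=> muE E mE.
pose G : set (set (k.-tuple T)) :=
  [set B | exists2 A : 'I_k -> set T, (forall i, measurable (A i)) &
    B = [set D | forall i, A i (tnth D i)]].
have GT : G setT.
  by exists (fun=> setT) => //; apply/seteqP; split.
apply: (measure_unique G (fun=> setT)) => //.
- apply/seteqP; split; last first.
    apply: smallest_sub; first exact: sigma_algebra_measurable.
    by move=> _ [A mA ->]; exact: measurable_rectangle.
  apply: smallest_sub; first exact: smallest_sigma_algebra.
  move=> B; rewrite -bigcup_seq => -[i _ [Y mY <-]].
  apply: sub_sigma_algebra; exists (fun j => if j == i then Y else setT).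
    by move=> j; case: ifP.
  (* A cylinder over one coordinate is a rectangle with full other sides. *)
  apply/seteqP; split => [D [_ /= YD] j|D /= /(_ i)]; last by rewrite eqxx.
  by case: ifP => // /eqP ->.
- move=> _ _ [A mA ->] [B mB ->]; exists (fun i => A i `&` B i).
    by move=> i; exact: measurableI.
  apply/seteqP; split => [D [? ?] i|D AB]; first by split.
  by split => i; have [] := AB i.
- by apply/seteqP; split => // x _; exists 0%N.
- by move=> _ [A mA ->]; rewrite muE//; exact/esym/iid_rectangle.
- move=> _; rewrite (_ : setT = [set D | forall i, setT (tnth D i)]).
    rewrite (muE (fun=> setT))// big1 ?ltry// => i _.
    exact: probability_setT.
  by apply/seteqP; split.
Qed.

Definition select {T k M} (f : 'I_k -> 'I_M) (L : M.-tuple T) : k.-tuple T :=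
  [tuple tnth L (f i) | i < k].

Lemma measurable_select {d} {T : measurableType d} {k M} (f : 'I_k -> 'I_M) :
  measurable_fun [set: M.-tuple T] (select f).
Proof.
apply/measurable_fun_tnthP => i.
rewrite (_ : _ \o _ = (@tnth _ T ^~ (f i))); first exact: measurable_tnth.
by apply/funext => L /=; rewrite tnth_mktuple.
Qed.

HB.instance Definition _ d (T : measurableType d) k M (f : 'I_k -> 'I_M) :=
  isMeasurableFun.Build _ _ _ _ (@select T k M f) (measurable_select f).

(** The preimage of a rectangle with sides [A i] is a rectangle, whose side at
[f i] is [A i] and whose sides off the image of [f] are full: injectivity of
[f] keeps two sides from being imposed on the same draw. *)
Lemma iid_select d (T : measurableType d) (R : realType) (P : probability T R)
    k M (f : 'I_k -> 'I_M) : injective f -> forall E, measurable E ->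
  iid P M (select f @^-1` E) = iid P k E.
Proof.
move=> fI E mE; rewrite -[LHS]/(distribution (iid P M) (select f) E).
apply: iid_unique => // A mA.
pose B j := if [pick i | f i == j] is Some i then A i else setT.
have BfE i : B (f i) = A i.
  rewrite /B; case: pickP => [j /eqP/fI -> //|/(_ i)]; by rewrite eqxx.
have mB j : measurable (B j) by rewrite /B; case: pickP.
rewrite /distribution /pushforward /=.
transitivity (iid P M [set D | forall j, B j (tnth D j)]).
  congr (iid _ _ _); apply/seteqP; split => D /= h j.
    rewrite /B; case: pickP => // i /eqP <-.
    by have := h i; rewrite tnth_mktuple.
  by rewrite tnth_mktuple -BfE; exact: h.
rewrite iid_rectangle//.
rewrite (bigID (fun j => j \in [set f i | i in 'I_k]%SET))/=.
rewrite [X in (_ * X)%E]big1 ?mule1; last first.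
  move=> j; rewrite /B; case: pickP => [i /eqP <-|].
    by rewrite imset_f.
  by rewrite probability_setT.
rewrite big_imset/=; last by move=> i j _ _; exact: fI.
by apply: eq_big => // i _; rewrite BfE.
Qed.

Definition uncons {T n} (t : n.+1.-tuple T) : n.-tuple T * T :=
  ([tuple of behead t], thead t).

Lemma measurable_uncons {d} {T : measurableType d} {n} :
  measurable_fun [set: n.+1.-tuple T] uncons.
Proof.
apply: measurable_fun_pair; first exact: measurable_behead.
exact: measurable_tnth.
Qed.

HB.instance Definition _ d (T : measurableType d) n :=
  isMeasurableFun.Build _ _ _ _ (@uncons T n) measurable_uncons.

Lemma uncons_cons_pair d (T : measurableType d) n (w : T * n.-tuple T) :
  uncons (cons_pair w) = (w.2, w.1).
Proof.
by case: w => x t; rewrite /uncons theadE; congr pair; apply: val_inj.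
Qed.

(** Exchangeability: [iid] adds a new draw in front, whereas the test point
comes after the training data. *)
Lemma iid_uncons d (T : measurableType d) (R : realType) (P : probability T R)
    n E : measurable E ->
  (iid P n \x P)%E E = iid P n.+1 (uncons @^-1` E).
Proof.
move=> mE; rewrite -[RHS]/(distribution (iid P n.+1) uncons E).
apply: product_measure_unique => // A B mA mB.
rewrite muleC -product_measure1E//.
rewrite -[LHS]/((P \x iid P n)%E
  (@cons_pair _ T n @^-1` (uncons @^-1` (A `*` B)))).
congr (product_measure1 _ _ _); apply/seteqP.
by split => w; rewrite /preimage /mkset uncons_cons_pair => -[].
Qed.

Lemma sample_law_iid (R : realType) (d n : nat)
    (P : probability (observation R d) R) E :
  measurable E -> sample_law n P E = iid P n.+1 (uncons @^-1` E).
Proof. exact: iid_uncons. Qed.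

(** * Resampling from a finite population *)

Definition empirical {d} {T : measurableType d} (R : realType) {m}
    (L : m.+1.-tuple T) : set T -> \bar R :=
  mscale (m.+1%:R^-1)%:nng (msum (fun j => \d_(tnth L (inord j))) m.+1).

HB.instance Definition _ d (T : measurableType d) (R : realType) m
  (L : m.+1.-tuple T) := Measure.on (empirical R L).

Lemma empiricalE d (T : measurableType d) (R : realType) m
    (L : m.+1.-tuple T) A :
  empirical R L A =
  ((m.+1%:R^-1)%:E * \sum_(j < m.+1) \d_(tnth L j) A)%E.
Proof.
by congr (_ * _)%E; apply: eq_bigr => j _; rewrite inord_val.
Qed.

Lemma empirical_setT d (T : measurableType d) (R : realType) m
    (L : m.+1.-tuple T) : empirical R L setT = 1%E.
Proof.
rewrite empiricalE; under eq_bigr do rewrite diracT.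
rewrite -(big_morph _ EFinD erefl) sumr_const card_ord.
by rewrite -EFinM mulVf// pnatr_eq0.
Qed.

HB.instance Definition _ d (T : measurableType d) (R : realType) m
  (L : m.+1.-tuple T) :=
  Measure_isProbability.Build _ _ _ (empirical R L) (empirical_setT R L).

Lemma integral_empirical d (T : measurableType d) (R : realType) m
    (L : m.+1.-tuple T) D (f : T -> \bar R) : measurable D ->
  measurable_fun D f -> (forall x, D x -> 0 <= f x)%E ->
  (\int[empirical R L]_(x in D) f x =
  (m.+1%:R^-1)%:E * \sum_(j < m.+1) \d_(tnth L j) D * f (tnth L j))%E.
Proof.
move=> mD mf f0; rewrite ge0_integral_mscale// ge0_integral_measure_sum//.
congr (_ * _)%E; apply: eq_bigr => j _.
by rewrite integral_dirac// inord_val.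
Qed.

Lemma select_cons T k m (j : 'I_m) (t : k.-tuple 'I_m) (L : m.-tuple T) :
  select (tnth [tuple of j :: t]) L =
  [tuple of tnth L j :: select (tnth t) L].
Proof.
apply: eq_from_tnth => i; rewrite tnth_mktuple.
by case: (unliftP ord0 i) => [i' ->|->//]; rewrite !tnthS tnth_mktuple.
Qed.

Lemma big_tuple_cons (V : nmodType) (I : finType) k (F : k.+1.-tuple I -> V) :
  \sum_t F t = \sum_j \sum_(t : k.-tuple I) F [tuple of j :: t].
Proof.
rewrite pair_big/= (reindex 
  (fun p : I * k.-tuple I => [tuple of p.1 :: p.2]))//.
exists (fun t => (thead t, [tuple of behead t])) => [[j t] _|t _] /=.
  by congr pair; apply: val_inj.
by rewrite -tuple_eta.
Qed.

(** Sampling from the empirical law is sampling indices uniformly, with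
replacement. *)
Lemma iid_empirical d (T : measurableType d) (R : realType) m
    (L : m.+1.-tuple T) k (E : set (k.-tuple T)) : measurable E ->
  iid (empirical R L) k E =
  ((m.+1%:R ^- k)%:E *
    \sum_(t : k.-tuple 'I_m.+1) \d_(select (tnth t) L) E)%E.
Proof.
elim: k E => [|k IHk] E mE.
  rewrite expr0 invr1 mul1e (bigD1 [tuple])//= big1 ?adde0//.
    by rewrite [select _ _]tuple0.
  by move=> t; rewrite (tuple0 t) => /eqP.
have mE' : measurable (@cons_pair _ T k @^-1` E).
  by rewrite -[X in measurable X]setTI; exact: measurable_cons_pair.
rewrite /= /distribution /pushforward/=.
rewrite [LHS]/product_measure1 integral_empirical//; last first.
  exact: measurable_fun_xsection.
rewrite big_tuple_cons.
under eq_bigr => j _.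
  rewrite diracT mul1e /= IHk; last exact: measurable_xsection.
  over.
rewrite -ge0_sume_distrr; last by move=> j _; exact: sume_ge0.
rewrite muleA -EFinM exprS invfM; congr (_ * _)%E.
apply: eq_bigr => j _; apply: eq_bigr => t _.
rewrite select_cons !diracE; congr (_%:R%:E)%R; congr nat_of_bool.
by rewrite mem_xsection; apply/idP/idP; rewrite !inE.
Qed.

(** Sampling with replacement hits an index twice with probability at most
[k ^ 2 / m].  The inductive step costs the factor [k] in [k * m ^ k]: that many
tuples of size [k.+1] repeat at the last place. *)
Lemma expn_le_ffact m k : (m ^ k <= m ^_ k + k ^ 2 * m ^ k.-1)%N.
Proof.
have ffact_le j : (m ^_ j <= m ^ j)%N.
  elim: j => [//|j IHj].
  by rewrite ffactnSr expnSr leq_mul// leq_subr.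
elim: k => [//|k IHk]; rewrite ffactnSr expnSr /=.
apply: (leq_trans (leq_mul IHk (leqnn m))); rewrite mulnDl.
have -> : (k ^ 2 * m ^ k.-1 * m = k ^ 2 * m ^ k)%N.
  by case: k {IHk} => [//|k] /=; rewrite -mulnA -expnSr.
have : (m ^_ k * m <= m ^_ k * (m - k) + m ^ k * k)%N.
  rewrite (leq_trans (leq_mul (leqnn _) (_ : m <= m - k + k)%N))//; first lia.
  by rewrite mulnDr leq_add2l leq_mul.
have -> : (k.+1 ^ 2 = k ^ 2 + k + k.+1)%N by lia.
rewrite !mulnDl mulSn (mulnC (m ^ k)%N k); lia.
Qed.

Lemma sum_iid_select_le d (T : measurableType d) (R : realType)
    (P : probability T R) k m (E : set (k.-tuple T)) : measurable E ->
  (\sum_(t : k.-tuple 'I_m) iid P m (select (tnth t) @^-1` E) <=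
   (m%:R ^+ k)%:E * iid P k E + (k ^ 2 * m ^ k.-1)%:R%:E)%E.
Proof.
move=> mE.
have pE : iid P k E = (fine (iid P k E))%:E.
  by rewrite fineK// fin_num_measure.
set p := fine _ in pE; have p0 : 0 <= p by rewrite fine_ge0.
(* Only the tuples with a repetition are not covered by iid_select. *)
pose N := (\sum_(t : k.-tuple 'I_m) ~~ uniq t)%N.
have N_le : (N <= k ^ 2 * m ^ k.-1)%N.
  have uniqE : (m ^_ k = \sum_(t : k.-tuple 'I_m) uniq t)%N.
    rewrite -[in LHS](card_ord m) -(card_uniq_tuples _ predT) -sum1dep_card.
    by rewrite big_mkcond; apply: eq_bigr => t _; rewrite all_predT; case: uniq.
  have cardN : (N + m ^_ k = m ^ k)%N.
    rewrite uniqE -big_split/= -[in RHS](card_ord m) -card_tuple -sum1_card.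
    by apply: eq_bigr => t _; case: uniq.
  by rewrite -(leq_add2r (m ^_ k)) cardN addnC expn_le_ffact.
have le_term (t : k.-tuple 'I_m) :
    (iid P m (select (tnth t) @^-1` E) <= (p + (~~ uniq t)%:R)%:E)%E.
  have [/tuple_uniqP tI|_] := boolP (uniq t).
    by rewrite iid_select// pE addr0.
  apply: (le_trans (probability_le1 _ _)).
    by rewrite -[X in measurable X]setTI; exact: measurable_select.
  by rewrite lee_fin lerDr.
apply: (le_trans (lee_sum _ (fun t _ => le_term t))).
rewrite sumEFin pE -EFinM -EFinD lee_fin big_split/= sumr_const.
by rewrite card_tuple card_ord -natrX mulr_natl lerD2l -natr_sum ler_nat.
Qed.

Lemma measurable_iid_empirical d (T : measurableType d) (R : realType) m k
    (E : set (k.-tuple T)) : measurable E ->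
  measurable_fun setT (fun L : m.+1.-tuple T => iid (empirical R L) k E).
Proof.
move=> mE; under eq_fun do rewrite iid_empirical//.
apply: measurable_funeM; apply: emeasurable_sum => t.
apply/measurable_EFinP.
rewrite (_ : (fun L => _) = \1_E \o select (tnth t))//.
apply: measurableT_comp; last exact: measurable_select.
exact: measurable_indic.
Qed.

(** Once the population is averaged out, resampling it differs from sampling
[P] only by the repeated indices. *)
Lemma integral_iid_empirical_le d (T : measurableType d) (R : realType)
    (P : probability T R) k m (E : set (k.-tuple T)) : measurable E ->
  (\int[iid P m.+1]_L iid (empirical R L) k E <=
   iid P k E + ((k ^ 2)%:R / m.+1%:R)%:E)%E.
Proof.
move=> mE; pose c : R := m.+1%:R ^- k.
have c0 : 0 <= c by rewrite invr_ge0 exprn_ge0.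
have mS (t : k.-tuple 'I_m.+1) : measurable (select (tnth t) @^-1` E).
  by rewrite -[X in measurable X]setTI; exact: measurable_select.
have mind (t : k.-tuple 'I_m.+1) :
    measurable_fun setT (fun L => \d_(select (tnth t) L) E : \bar R).
  rewrite (_ : (fun L => _) = EFin \o \1_(select (tnth t) @^-1` E))//.
  by apply/measurable_EFinP; exact: measurable_indic.
have -> : (\int[iid P m.+1]_L iid (empirical R L) k E =
    c%:E * \sum_(t : k.-tuple 'I_m.+1) iid P m.+1 (select (tnth t) @^-1` E))%E.
  under eq_integral do rewrite iid_empirical//.
  rewrite ge0_integralZl//; last 2 first.
  - by apply: emeasurable_sum => t; exact: mind.
  - by move=> L _; rewrite sume_ge0.
  rewrite ge0_integral_sum//; congr (_ * _)%E; apply: eq_bigr => t _.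
  rewrite -[LHS]/(\int[_]_L (\1_(select (tnth t) @^-1` E) L)%:E)%E.
  by rewrite integral_indic ?setIT.
apply: (le_trans (lee_wpmul2l _ (sum_iid_select_le P m.+1 mE))) => //.
have pE : iid P k E = (fine (iid P k E))%:E.
  by rewrite fineK// fin_num_measure.
rewrite pE -!EFinM -!EFinD lee_fin mulrDr mulrA mulVf ?mul1r; last first.
  by rewrite expf_neq0// pnatr_eq0.
rewrite lerD2l; case: k {E mE pE mS mind} @c c0 => [|k] c _.
  by rewrite mulr0 mul0r.
rewrite natrM mulrCA ler_wpM2l//.
by rewrite natrX /c exprS invfM -mulrA mulVf ?mulr1.
Qed.

(** * Populations with distinct covariates *)

Lemma med_dirac (R : realType) (med : (set R -> \bar R) -> R) (y : R) :
  median_rule med -> med (\d_y) = y.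
Proof.
move=> [/(_ (\d_y))[le_half ge_half] _].
have half A : ((2^-1)%:E <= \d_y A :> \bar R)%E -> A y.
  rewrite diracE; case: (boolP (y \in A)) => [/set_mem//|_].
  by rewrite lee_fin leNgt invr_gt0 ltr0n.
move: (half _ le_half) (half _ ge_half); rewrite /= !in_itv/= andbT => yle ley.
by apply/eqP; rewrite eq_le ley yle.
Qed.

Section label.
Context d (S : measurableType d) (R : realType).
(** Makes a collision of two covariates an event, and singletons measurable. *)
Hypothesis mdiag : measurable [set p : S * S | p.1 = p.2].

Lemma measurable_set1_diag (x : S) : measurable [set x].
Proof.
rewrite (_ : [set x] = xsection [set p : S * S | p.1 = p.2] x).
  exact: measurable_xsection.
by apply/seteqP; split => y; rewrite /xsection/= inE.
Qed.

(** The response that goes with the covariate [x] in a population with distinct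
covariates, where at most one term is nonzero; written as a sum, it is
measurable term by term. *)
Definition label m (L : m.-tuple (S * R)) (x : S) : R :=
  \sum_(j < m) (tnth L j).2 * \1_[set (tnth L j).1] x.

Lemma measurable_label m (L : m.-tuple (S * R)) : measurable_fun setT (label L).
Proof.
apply: measurable_sum => j; apply: measurable_funM => //.
by apply: measurable_indic; exact: measurable_set1_diag.
Qed.

Definition distinct m (L : m.-tuple (S * R)) :=
  injective (fun j => (tnth L j).1).

Lemma label_tnth m (L : m.-tuple (S * R)) j : distinct L ->
  label L (tnth L j).1 = (tnth L j).2.
Proof.
move=> dL; rewrite /label (bigD1 j)//= indicE mem_set// mulr1.
rewrite big1 ?addr0// => i ij; rewrite indicE memNset ?mulr0//=.
by move=> /dL ji; rewrite ji eqxx in ij.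
Qed.

Lemma conditional_law_empirical m (L : m.+1.-tuple (S * R)) : distinct L ->
  conditional_law (empirical R L) (kdirac (measurable_label L)).
Proof.
move=> dL A B mA mB.
have mk : measurable_fun setT
    (fun x => kdirac (measurable_label L) x B : \bar R).
  exact: measurable_kernel.
rewrite [RHS]ge0_integral_pushforward//; last exact: measurable_funTS.
have mAf : measurable (fst @^-1` A : set (S * R)).
  by rewrite -[X in measurable X]setTI; exact: measurable_fst.
rewrite integral_empirical//; last first.
  by apply: measurable_funTS; exact: (measurableT_comp mk).
rewrite [LHS]empiricalE; congr (_ * _)%E; apply: eq_bigr => j _.
rewrite /= label_tnth// /kdirac !diracE -EFinM -natrM mulnb.
congr (_%:R%:E)%R; congr nat_of_bool.
by apply/idP/andP; rewrite !inE/= => -[].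
Qed.

(** Two draws at distinct indices are independent ([iid_select]); given one of
them, the other one hits its covariate with probability zero. *)
Lemma ae_distinct (P : probability (S * R)%type R) m :
  nonatomic (covariate_law P) ->
  {ae iid P m, forall L, distinct L}.
Proof.
move=> P0.
have dneq : \forall L \ae iid P m, forall ij : 'I_m * 'I_m,
    ij.1 != ij.2 -> (tnth L ij.1).1 != (tnth L ij.2).1.
  apply: filter_forall => -[i j]; rewrite /=.
  case: (eqVneq i j) => [_|ij]; first exact: nearW.
  pose f := tnth [tuple i; j].
  have fI : injective f by apply/tuple_uniqP; rewrite /= inE ij.
  pose E := [set w : 1.-tuple (S * R) * (S * R) | (thead w.1).1 = w.2.1].
  have mE : measurable E.
    rewrite (_ : E = (fun w : 1.-tuple (S * R) * (S * R) =>
      ((thead w.1).1, w.2.1)) @^-1` [set p | p.1 = p.2])//.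
    rewrite -[X in measurable X]setTI.
    apply: measurable_fun_pair => //; last exact: measurableT_comp.
    apply: measurableT_comp => //; apply: measurableT_comp => //.
    exact: measurable_tnth.
  have mE' : measurable (uncons @^-1` E).
    by rewrite -[X in measurable X]setTI; exact: measurable_uncons.
  exists (select f @^-1` (uncons @^-1` E)); split.
  - by rewrite -[X in measurable X]setTI; exact: measurable_select.
  - rewrite /= iid_select// -iid_uncons// [LHS]/product_measure1.
    rewrite integral0_eq// => t _.
    rewrite -[RHS](P0 (thead t).1) /=; congr (P _).
    apply/seteqP; split => z; rewrite /xsection/= inE /E/=; exact: esym.
  - move=> L /= /not_implyP[_ /negP]; rewrite negbK => /eqP.
    rewrite /E/= /thead tnth_behead !tnth_mktuple.
    by rewrite /f !(tnth_nth i)/= inordK// => ->.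
apply: filterS dneq => L dL i j; apply: contraPP => /eqP ij.
by apply/eqP; exact: (dL (i, j)).
Qed.
End label.

Lemma measurable_diag_tuple (R : realType) d :
  measurable [set p : covariate R d * covariate R d | p.1 = p.2].
Proof.
rewrite (_ : [set _ | _] = \bigcap_(i in [set: 'I_d])
   [set p | tnth p.1 i == tnth p.2 i]).
  apply: fin_bigcap_measurable => // i _.
  rewrite -[X in measurable X]setTI.
  apply: (@measurable_fun_eqr _ _ _ setT
    (fun p => tnth p.1 i) (fun p => tnth p.2 i)) => //.
  - by apply: (measurableT_comp (measurable_tnth i)).
  - by apply: (measurableT_comp (measurable_tnth i)).
apply/seteqP; split => p /=; first by move=> pE i _; rewrite /= pE.
by move=> h; apply: eq_from_tnth => i; apply/eqP/h.
Qed.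

(** * Coverage *)

(** A resampled test point is an entry of [L], hence its response is the label
of its covariate, which is also the conditional median there. *)
Lemma coverage_empirical (R : realType) (d n m : nat) (alpha : R)
    (med : (set R -> \bar R) -> R) (hmed : median_rule med)
    (C : algorithm R d n) (mC : measurable_algorithm C)
    (hC : median_coverage med alpha C) (L : m.+1.-tuple (observation R d)) :
  distinct L ->
  ((1 - alpha)%:E <=
    iid (empirical R L) n.+1 (uncons @^-1` [set w | C w.1 w.2.1 w.2.2]))%E.
Proof.
move=> dL; have mdiag := @measurable_diag_tuple R d.
have := hC _ _ (conditional_law_empirical mdiag dL).
set E := [set w | C w.1 w.2.1 w.2.2].
set Emed := [set w | _].
have EmedE : Emed = (fun w => (w.1, (w.2.1, label L w.2.1))) @^-1` E.
  by apply/seteqP; split => w; rewrite /Emed /= /kdirac med_dirac.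
have mEmed : measurable Emed.
  rewrite EmedE -[X in measurable X]setTI.
  apply: measurable_fun_pair => //; apply: measurable_fun_pair.
    exact: measurableT_comp.
  apply: (measurableT_comp (measurable_label mdiag L)).
  exact: measurableT_comp.
have mEmed' : measurable (uncons @^-1` Emed).
  by rewrite -[X in measurable X]setTI; exact: measurable_uncons.
have mE' : measurable (uncons @^-1` E).
  by rewrite -[X in measurable X]setTI; exact: measurable_uncons.
rewrite sample_law_iid// !iid_empirical//; congr (_ <= _ * _)%E.
apply: eq_bigr => t _; rewrite !diracE; congr (_%:R%:E)%R; congr nat_of_bool.
have tE : label L (thead (select (tnth t) L)).1 = (thead (select (tnth t) L)).2.
  by rewrite /thead tnth_mktuple label_tnth.
by rewrite EmedE; apply/idP/idP; rewrite !inE /E /= tE.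
Qed.

Lemma le_of_inverse_bound (R : realType) (x y : R) (K : nat) :
  (forall m, x <= y + K%:R / m.+1%:R) -> x <= y.
Proof.
move=> xy; apply/ler_addgt0Pr => e e0.
apply: (le_trans (xy (Num.truncn (K%:R / e)))); rewrite lerD2l.
rewrite ler_pdivrMr ?ltr0n// mulrC -ler_pdivrMr//.
by rewrite ltW// Num.Theory.truncnS_gt.
Qed.

Unset Implicit Arguments.

Theorem theorem5 (R : realType) (d n : nat) (hd : (0 < d)%N) (hn : (0 < n)%N)
    (alpha : R) (halpha0 : 0 < alpha) (halpha1 : alpha < 1)
    (med : (set R -> \bar R) -> R) (hmed : median_rule med)
    (C : algorithm R d n) (mC : measurable_algorithm C)
    (hC : median_coverage med alpha C)
    (P : probability (observation R d) R)
    (hP : nonatomic (covariate_law P)) :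
  predictive_coverage_at alpha C P.
Proof.
have mE' : measurable (uncons @^-1` [set w | C w.1 w.2.1 w.2.2]).
  by rewrite -[X in measurable X]setTI; exact: measurable_uncons.
rewrite /predictive_coverage_at sample_law_iid//.
set E := uncons @^-1` _ in mE' *.
have pE : iid P n.+1 E = (fine (iid P n.+1 E))%:E.
  by rewrite fineK// fin_num_measure.
rewrite pE lee_fin; apply: (@le_of_inverse_bound _ _ _ (n.+1 ^ 2)) => m.
rewrite -lee_fin [leRHS]EFinD -pE.
apply: (le_trans _ (integral_iid_empirical_le P m mE')).
rewrite -[leLHS]mule1 -(probability_setT (iid P m.+1)) -integral_cst//.
apply: ae_ge0_le_integral => //.
- by move=> L _; rewrite lee_fin subr_ge0 ltW.
- exact: measurable_iid_empirical.
- apply: filterS (ae_distinct (@measurable_diag_tuple R d) m.+1 hP) => L dL _.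
  exact: (coverage_empirical hmed).
Qed.
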